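(* Let $K$ be a field of characteristic $p>0$ with algebraic closure $\overline{K}$ and separable closure $K^{\mathrm{sep}}\subseteq\overline{K}$. Write $\mathrm{AS}(x)=x^p-x$. Let $L=K(\alpha)$ where $\alpha\in\overline{K}$ satisfies $\mathrm{AS}(\alpha)\in K\setminus\mathrm{AS}(K)$, and let $\sigma\in\mathrm{Gal}(K^{\mathrm{sep}}/K)$ be such that $\sigma(\alpha)=\alpha+1$. Let $M=L(\eta)$ where $\eta\in\overline{K}$ satisfies $b:=\mathrm{AS}(\eta)\in L\setminus\mathrm{AS}(L)$. Then the extension $M/K$ is Galois if and only if $\sigma(b)-b\in\mathrm{AS}(L)$.
   Context: For a subfield $F\subseteq\overline{K}$, $\mathrm{AS}(F)=\{x^p-x\mid x\in F\}$. *)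

(* Defs.v *)
From HB Require Import structures.
From mathcomp Require Import all_boot all_order all_algebra.
From mathcomp Require Import separable.
From mathcomp Require Import boolp classical_sets functions.
Set Implicit Arguments.
Unset Strict Implicit.
Unset Printing Implicit Defensive.
Import GRing.Theory.
Local Open Scope classical_set_scope.
Local Open Scope ring_scope.

(* The algebraic extensions of K considered here may be infinite (the         *)
(* algebraic and separable closures), so fieldext/galois do not apply.        *)
(* All of them are subsets of one algebraically closed field Kbar, in which   *)
(* K is embedded by iota : {rmorphism K -> Kbar}.                             *)

Definition is_algebraic_closure (K : fieldType) (Kbar : closedFieldType)
    (iota : {rmorphism K -> Kbar}) : Prop :=
  forall x : Kbar, algebraicOver iota x.

Definition is_subfield (T : fieldType) (F : set T) : Prop :=
  divring_closed (mem F).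

Definition adjoin (T : fieldType) (F : set T) (x : T) : set T :=
  smallest (@is_subfield T) (F `|` [set x]).

Definition AS (T : fieldType) (p : nat) (x : T) : T := x ^+ p - x.

Section OverK.
Variables (K : fieldType) (Kbar : closedFieldType).
Variable iota : {rmorphism K -> Kbar}.

Definition is_minpoly (x : Kbar) (q : {poly K}) : Prop :=
  [/\ q \is monic, irreducible_poly q & root (map_poly iota q) x].

Definition separable_over (x : Kbar) : Prop :=
  exists2 q : {poly K}, is_minpoly x q & separable_poly q.

Definition Ksep : set Kbar := [set x | separable_over x].

Definition splits_in (E : set Kbar) (q : {poly K}) : Prop :=
  exists2 rs : seq Kbar, {subset rs <= E} &
    map_poly iota q %= \prod_(r <- rs) ('X - r%:P).

Definition separable_ext (E : set Kbar) : Prop :=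
  forall x, E x -> separable_over x.

Definition normal_ext (E : set Kbar) : Prop :=
  forall x, E x -> algebraicOver iota x /\
    forall q : {poly K}, irreducible_poly q -> root (map_poly iota q) x ->
      splits_in E q.

Definition galois_ext (E : set Kbar) : Prop :=
  [/\ is_subfield E, range iota `<=` E, separable_ext E & normal_ext E].

(* Gal E is Gal(E / K).  An automorphism of E is carried by a function on     *)
(* Kbar whose values outside E are irrelevant (compare kAut in galois.v).     *)
Definition Gal (E : set Kbar) : set (Kbar -> Kbar) :=
  [set s | [/\ set_bij E E s,
               {in E &, {morph s : x y / x + y}},
               {in E &, {morph s : x y / x * y}} &
               forall a : K, s (iota a) = iota a]].

End OverK.

(* Main.v *)
(* The set of roots in an extension E of K of an irreducible polynomial q over
   K is permuted by any K-endomorphism of E.  Hence, if a family of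
   K-endomorphisms of E has fixed field K, the product of the X - r over these
   roots r lies in K[X] and is divisible by q; so q splits in E with simple
   roots, and E/K is Galois.

   If sigma(b) = b + AS(c), then sigma extends to M by eta |-> eta + c, and
   together with eta |-> eta + 1 it has fixed field K.  Conversely, if M/K is
   Galois, then u = sigma(eta) lies in M and AS(u) = sigma(b); the generator
   tau : eta |-> eta + 1 moves u by some n in F_p, so u - n eta lies in L and
   sigma(b) = n b + AS(c).  Iterating p times, b = n b modulo AS(L), because
   sigma^p = 1 on L and n^p = n; as b is not in AS(L), n = 1. *)

Require Import Defs.
From HB Require Import structures.
From mathcomp Require Import all_boot all_order all_algebra.
From mathcomp Require Import separable fieldext ring.
From mathcomp Require Import boolp classical_sets functions.
Import GRing.Theory.
Local Open Scope classical_set_scope.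
Local Open Scope ring_scope.

Set Implicit Arguments.
Unset Strict Implicit.

(** * The map [AS] in characteristic [p] and the polynomial [X^p - X - b] *)

Section ArtinSchreierMap.
Variables (p : nat) (F : fieldType).
Hypothesis pcharF : p \in [pchar F].
Implicit Types (x y b : F) (n : nat).

Lemma AS_B x y : AS p (x - y) = AS p x - AS p y.
Proof.
have := pFrobenius_autB_comm pcharF (mulrC x y).
by rewrite !pFrobenius_autE /AS => ->; ring.
Qed.

(** The elements [n%:R] form the prime field, which Frobenius fixes; hence [AS] is linear over
    it. *)
Lemma AS_natM n x : AS p (n%:R * x) = n%:R * AS p x.
Proof.
have := pFrobenius_aut_nat pcharF n; rewrite pFrobenius_autE => nE.
by rewrite /AS exprMn nE mulrBr.
Qed.

Lemma AS_nat n : AS p (n%:R : F) = 0.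
Proof.
have := pFrobenius_aut_nat pcharF n; rewrite pFrobenius_autE => nE.
by rewrite /AS nE subrr.
Qed.

Lemma AS_D x y : AS p (x + y) = AS p x + AS p y.
Proof.
by rewrite -[y in LHS]opprK AS_B -[- y]sub0r AS_B (AS_nat 0) sub0r opprK.
Qed.

Lemma AS_addn x n : AS p (x + n%:R) = AS p x.
Proof. by rewrite AS_D AS_nat addr0. Qed.

Lemma natr_inj_ltp : {in iota 0 p &, injective (fun n => n%:R : F)}.
Proof.
move=> m n; rewrite !mem_iota !add0n /= => mp np.
wlog le_mn : m n mp np / (m <= n)%N => [hw|].
  by case: (leqP m n) => [|/ltnW] le; [exact: hw | move=> e; rewrite (hw n m)].
move=> /eqP; rewrite eq_sym -subr_eq0 -natrB // -(dvdn_pcharf pcharF) => dvd.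
case: (posnP (n - m)%N) => [/eqP le_nm|/dvdn_leq /(_ dvd) le_p].
  by apply/eqP; rewrite eqn_leq le_mn.
by have := leq_ltn_trans (leq_subr m n) np; rewrite ltnNge le_p.
Qed.

Definition AS_poly b : {poly F} := 'X^p - 'X - b%:P.

Lemma root_AS_poly b x : root (AS_poly b) x = (AS p x == b).
Proof. by rewrite /root !(hornerE, hornerXn) subr_eq0. Qed.

Lemma size_AS_poly b : size (AS_poly b) = p.+1.
Proof.
have p1 : (1 < p)%N := prime_gt1 (pcharf_prime pcharF).
rewrite /AS_poly -addrA size_polyDl ?size_polyXn //.
rewrite -opprD size_polyN size_polyDl ?size_polyX ?ltnS //.
by rewrite size_polyC; case: eqP.
Qed.

Lemma monic_AS_poly b : AS_poly b \is monic.
Proof.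
have p1 : (1 < p)%N := prime_gt1 (pcharf_prime pcharF).
rewrite monicE lead_coefE size_AS_poly /= !coefE eqxx.
by rewrite (gtn_eqF p1) -if_neg -lt0n ltnW // subr0 subr0.
Qed.

(** The [p] translates [x + n] are distinct roots of a monic polynomial of degree [p], so they are
    all of its roots. *)
Lemma AS_poly_factor b x : AS p x = b ->
  AS_poly b = \prod_(y <- [seq x + n%:R | n <- iota 0 p]) ('X - y%:P).
Proof.
move=> xb; rewrite [LHS](@all_roots_prod_XsubC _ _ [seq x + n%:R | n <- iota 0 p]).
- by rewrite (monicP (monic_AS_poly b)) scale1r.
- by rewrite size_AS_poly size_map size_iota.
- by apply/allP => _ /mapP[n _ ->]; rewrite root_AS_poly AS_addn xb.
rewrite uniq_rootsE map_inj_in_uniq ?iota_uniq // => m n mp np /addrI.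
exact: natr_inj_ltp.
Qed.

Lemma AS_eqP b x y : AS p x = b -> AS p y = b ->
  exists2 n, (n < p)%N & y = x + n%:R.
Proof.
move=> /AS_poly_factor bE /eqP; rewrite -root_AS_poly bE root_prod_XsubC.
by move=> /mapP[n]; rewrite mem_iota /= add0n => np ->; exists n.
Qed.

End ArtinSchreierMap.

(** * Base change and irreducibility of Artin-Schreier polynomials *)

Lemma rmorph_AS (p : nat) (F E : fieldType) (f : {rmorphism F -> E}) (x : F) :
  f (AS p x) = AS p (f x).
Proof. by rewrite /AS rmorphB rmorphXn. Qed.

Lemma map_AS_poly (p : nat) (F E : fieldType) (f : {rmorphism F -> E}) (b : F) :
  map_poly f (AS_poly p b) = AS_poly p (f b).
Proof. by rewrite /AS_poly !rmorphB /= map_polyXn map_polyX map_polyC. Qed.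

(** Otherwise [q] and [g] are coprime; coprimality survives the extension to [E] and excludes a
    common root. *)
Lemma root_irreducible_dvdp (F E : fieldType) (f : {rmorphism F -> E})
    (q g : {poly F}) (x : E) :
  irreducible_poly q -> root (map_poly f q) x -> root (map_poly f g) x -> q %| g.
Proof.
move=> qirr qx gx; apply: contraT; rewrite -irreducible_poly_coprime //.
rewrite -(coprimep_map f) => /coprimep_root /(_ qx).
by rewrite (eqP gx) eqxx.
Qed.

(** Over [E], a factor is up to a scalar a product over some of the roots [x + n]. If it is
    nontrivial and proper, the sum of these roots lies in [F] and forces [x] into [F], so that [b]
    is in the image of [AS]. *)
Lemma AS_poly_irreducible (p : nat) (F E : fieldType) (f : {rmorphism F -> E})
    (b : F) (x : E) :
  p \in [pchar F] -> AS p x = f b -> (forall y, AS p y <> b) ->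
  irreducible_poly (AS_poly p b).
Proof.
move=> pcharF xb nb.
have pcharE : p \in [pchar E] by rewrite (fmorph_pchar f).
have p1 : (1 < p)%N := prime_gt1 (pcharf_prime pcharF).
split=> [|q sq1 qdvd]; first by rewrite size_AS_poly // ltnS ltnW.
have q0 : q != 0.
  apply: contraTneq qdvd => ->; rewrite dvd0p -size_poly_eq0 size_AS_poly //.
have : map_poly f q %| map_poly f (AS_poly p b) by rewrite dvdp_map.
rewrite map_AS_poly (AS_poly_factor pcharE xb) big_map.
move=> /dvdp_prod_XsubC[m]; set s := mask m _ => /eqp_eq qE.
have sizeq : size q = (size s).+1.
  rewrite -(size_map_poly f) -(size_scale _ (_ : lead_coef (\prod_(i <- s) ('X - (x + i%:R)%:P)) != 0)).
    by rewrite qE size_scale ?size_prod_XsubC // lead_coef_eq0 map_poly_eq0.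
  by rewrite (monicP (monic_prod_XsubC _ _ _)) oner_eq0.
move: qE; rewrite (monicP (monic_prod_XsubC _ _ _)) scale1r => qE.
(* If [s] has all [p] roots, [q] is associate to the whole polynomial. Otherwise [0 < size s < p],
   so [size s] is invertible in [F]. *)
have [ltsp|] := ltnP (size s) p; last first.
  move=> lesp; rewrite -dvdp_size_eqp // eqn_leq dvdp_leq ?monic_neq0 ?monic_AS_poly //=.
  by rewrite size_AS_poly // sizeq ltnS.
have s0 : (0 < size s)%N by rewrite lt0n; apply: contra_neq sq1; rewrite sizeq => ->.
have lcq : lead_coef q != 0 by rewrite lead_coef_eq0.
have sn0 : (size s)%:R != 0 :> F.
  by rewrite -(dvdn_pcharf pcharF) gtnNdvd.
(* The roots of [q] being [x + n] with [n] in [s], its subleading coefficient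
   expresses [size s * x] over [F]. *)
have := congr1 (fun g : {poly E} => g`_(size s).-1) qE.
rewrite coef_map coefZ lead_coef_map -(big_map (fun n => x + n%:R) xpredT (fun y => 'X - y%:P)).
rewrite -{2}[size s](size_map (fun n => x + n%:R)) coefPn_prod_XsubC; last first.
  by rewrite size_map -lt0n.
rewrite big_map big_split /= big_const_seq count_predT iter_addr_0 -mulr_natl -natr_sum.
move=> qE1.
have xE : x = f ((- (q`_(size s).-1 / lead_coef q) - (\sum_(n <- s) n)%:R) / (size s)%:R).
  have fl : f (lead_coef q) != 0 by rewrite fmorph_eq0.
  have fn : (size s)%:R != 0 :> E by rewrite -(rmorph_nat f) fmorph_eq0.
  rewrite fmorph_div rmorphB rmorphN fmorph_div !rmorph_nat qE1 mulrAC mulfV // mul1r.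
  by rewrite opprK addrK mulrAC mulfV // mul1r.
case: (nb ((- (q`_(size s).-1 / lead_coef q) - (\sum_(n <- s) n)%:R) / (size s)%:R)).
by apply: (fmorph_inj f); rewrite rmorph_AS -xE.
Qed.

(** * Subfields given as sets, and simple extensions as field types *)

Lemma is_subfield_range (E T : fieldType) (j : {rmorphism E -> T}) :
  is_subfield (range j).
Proof.
split; first by apply/mem_set; exists 1; rewrite ?rmorph1.
- move=> _ _ /set_mem[x _ <-] /set_mem[y _ <-].
  by apply/mem_set; exists (x - y); rewrite ?rmorphB.
- move=> _ _ /set_mem[x _ <-] /set_mem[y _ <-].
  by apply/mem_set; exists (x / y); rewrite ?fmorph_div.
Qed.

Lemma is_subfield_smallest (T : fieldType) (A : set T) :
  is_subfield (smallest (@is_subfield T) A).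
Proof.
split; first by apply/mem_set => B [[B1 _ _] _]; apply/set_mem.
- move=> x y /set_mem xA /set_mem yA; apply/mem_set => B [Bf AB]; apply/set_mem.
  have [_ BB _] := Bf.
  by apply: BB; apply/mem_set; [exact: xA | exact: yA].
- move=> x y /set_mem xA /set_mem yA; apply/mem_set => B [Bf AB]; apply/set_mem.
  have [_ _ BV] := Bf.
  by apply: BV; apply/mem_set; [exact: xA | exact: yA].
Qed.

Lemma subfield_horner (F T : fieldType) (f : {rmorphism F -> T}) (A : set T)
    (g : {poly F}) (u : T) :
  is_subfield A -> range f `<=` A -> A u -> A (map_poly f g).[u].
Proof.
move=> [A1 AB AV] fA Au; apply/set_mem.
have A0 : 0 \in mem A by rewrite -(subrr 1) AB.
have AD x y : x \in mem A -> y \in mem A -> x + y \in mem A.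
  by move=> Ax Ay; rewrite -[y]opprK AB // -[- y]sub0r AB.
have AM x y : x \in mem A -> y \in mem A -> x * y \in mem A.
  by move=> Ax Ay; rewrite -[y]invrK AV // -[y^-1]mul1r AV.
elim/poly_ind: g => [|g c IHg]; first by rewrite rmorph0 horner0.
rewrite rmorphD rmorphM /= map_polyX map_polyC hornerMXaddC AD // ?AM //.
  by apply/mem_set.
by apply/mem_set/fA; exists c.
Qed.

(** This turns the set [adjoin (range f) u] into a field type [E] embedded by [j]. As [u] is
    algebraic, polynomial expressions in [u] already form a field. *)
Lemma adjoin_fieldType (F T : fieldType) (f : {rmorphism F -> T}) (u : T) :
  algebraicOver f u ->
  exists (E : fieldType) (i : {rmorphism F -> E}) (j : {rmorphism E -> T}) (t : E),
    [/\ forall x, j (i x) = f x, j t = u, range j = adjoin (range f) u &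
        forall x, exists g : {poly F}, x = (map_poly i g).[t]].
Proof.
case=> q q0 qu.
pose E : fieldType := subFExtend f u q.
pose i : {rmorphism F -> E} := inj_subfx f u q.
pose j : {rmorphism E -> T} := subfx_inj.
pose t : E := subfx_root f u q.
have jt : j t = u by exact: (subfx_inj_root qu q0).
have ji x : j (i x) = f x.
  by rewrite /i /inj_subfx /j /= (subfx_inj_eval qu q0) map_polyC hornerC.
have gen x : exists g : {poly F}, x = (map_poly i g).[t].
  have [g xg] := subfxE x; exists g; apply: (@fmorph_inj _ _ j).
  rewrite -horner_map /= -map_poly_comp jt (eq_map_poly ji) xg.
  by rewrite /j /= (subfx_inj_eval qu q0).
exists E, i, j, t; split=> //; apply/seteqP; split.
  move=> _ [x _ <-]; have [g ->] := gen x.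
  rewrite -horner_map /= -map_poly_comp jt (eq_map_poly ji).
  apply: (@subfield_horner _ _ f (adjoin (range f) u)); first exact: is_subfield_smallest.
    by move=> y fy; apply: sub_gen_smallest; left.
  by apply: sub_gen_smallest; right.
apply: smallest_sub; first exact: is_subfield_range.
by move=> _ [[x _ <-]|->]; [exists (i x)|exists t].
Qed.

Lemma rmorphism_of (E T : fieldType) (h : E -> T) :
  zmod_morphism h -> monoid_morphism h -> exists h' : {rmorphism E -> T}, h' =1 h.
Proof.
move=> hB hM.
pose hBm := GRing.isZmodMorphism.Build E T h hB.
pose hMm := GRing.isMonoidMorphism.Build E T h hM.
by exists (HB.pack h hBm hMm : {rmorphism E -> T}).
Qed.

(** * Extending morphisms to simple and Artin-Schreier extensions *)

Section SimpleExtension.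
Variables (F E : fieldType) (i : {rmorphism F -> E}) (t : E).
Hypothesis gen_t : forall x, exists g : {poly F}, x = (map_poly i g).[t].

Lemma extend_rmorphism (T : fieldType) (s : {rmorphism F -> T}) (q : {poly F})
    (u : T) :
  irreducible_poly q -> root (map_poly i q) t -> root (map_poly s q) u ->
  exists2 h : {rmorphism E -> T}, forall x, h (i x) = s x & h t = u.
Proof.
move=> qirr qt qu; have [rep repE] := choice gen_t.
(* The value at [u] does not depend on the chosen representative: two representatives differ by a
   multiple of [q], and the image of [q] under [s] vanishes at [u]. *)
have hwd g x : x = (map_poly i g).[t] ->
    (map_poly s (rep x)).[u] = (map_poly s g).[u].
  move=> xE; have : root (map_poly i (rep x - g)) t.
    by rewrite /root rmorphB hornerD hornerN -repE xE subrr.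
  move=> /(root_irreducible_dvdp qirr qt).
  rewrite -(dvdp_map s) => /dvdpP[r rE].
  have := congr1 (horner^~ u) rE.
  rewrite /= rmorphB hornerD hornerN hornerM (eqP qu) mulr0 => /eqP.
  by rewrite subr_eq0 => /eqP.
have [||h hE] := @rmorphism_of E T (fun x => (map_poly s (rep x)).[u]).
- move=> x y /=; rewrite -hornerN -hornerD -rmorphB; apply: hwd.
  by rewrite rmorphB hornerD hornerN -!repE.
- split=> [|x y] /=.
    by rewrite (hwd 1) ?rmorph1 ?hornerC // rmorph1 hornerC.
  rewrite -hornerM -rmorphM; apply: hwd.
  by rewrite rmorphM hornerM -!repE.
exists h => [x|]; rewrite hE.
  by rewrite (hwd x%:P) map_polyC hornerC.
by rewrite (hwd 'X) map_polyX hornerX.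
Qed.

Section Cyclic.
Variables (p : nat) (b : F).
Hypotheses (pcharF : p \in [pchar F]) (tb : AS p t = i b).
Hypothesis nb : forall y, AS p y <> b.

Lemma extend_AS (T : fieldType) (s : {rmorphism F -> T}) (u : T) :
  AS p u = s b ->
  exists2 h : {rmorphism E -> T}, forall x, h (i x) = s x & h t = u.
Proof.
move=> ub; apply: (@extend_rmorphism _ _ (AS_poly p b)).
- exact: AS_poly_irreducible tb nb.
- by rewrite map_AS_poly root_AS_poly tb.
- by rewrite map_AS_poly root_AS_poly ub.
Qed.

Lemma AS_translation :
  exists2 h : {rmorphism E -> E}, forall x, h (i x) = i x & h t = t + 1.
Proof.
have pcharE : p \in [pchar E] by rewrite (fmorph_pchar i).
by apply: extend_AS; rewrite (AS_addn pcharE _ 1).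
Qed.

(* If [x = g(t)] with [size g <= p], then [g - x] vanishes at the [p] points
   [t + n], so [g] is constant. *)
Lemma AS_fixed (h : {rmorphism E -> E}) (x : E) :
  (forall y, h (i y) = i y) -> h t = t + 1 -> h x = x -> exists y, x = i y.
Proof.
move=> hi ht hx; have [g0 xg0] := gen_t x.
have pcharE : p \in [pchar E] by rewrite (fmorph_pchar i).
(* The modulus vanishes at [t], so the remainder still represents [x], now with size at most [p]. *)
pose g := g0 %% AS_poly p b.
have xg : x = (map_poly i g).[t].
  rewrite xg0 {1}(divp_eq g0 (AS_poly p b)) rmorphD rmorphM hornerD hornerM.
  have /eqP -> : root (map_poly i (AS_poly p b)) t.
    by rewrite map_AS_poly root_AS_poly tb.
  by rewrite mulr0 add0r.
have sizeg : (size g <= p)%N.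
  rewrite -ltnS -(size_AS_poly pcharF b) ltn_modp.
  by rewrite monic_neq0 // monic_AS_poly.
have xn n : (map_poly i g).[t + n%:R] = x.
  elim: n => [|n IHn]; first by rewrite addr0.
  rewrite -natr1 addrCA addrC -ht -(rmorph_nat h) -rmorphD.
  have -> : map_poly i g = map_poly h (map_poly i g).
    by rewrite -map_poly_comp (eq_map_poly hi).
  by rewrite horner_map IHn.
have g0x : map_poly i g - x%:P = 0.
  apply/eqP; apply: contraT => gx0.
  pose ts := [seq t + n%:R | n <- iota 0 p].
  have : (size ts < size (map_poly i g - x%:P)%R)%N.
    apply: max_poly_roots gx0 _ _.
      by apply/allP => _ /mapP[n _ ->]; rewrite /root hornerD hornerN hornerC xn subrr.
    rewrite map_inj_in_uniq ?iota_uniq // => m n mp np /addrI.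
    exact: (natr_inj_ltp pcharE mp np).
  rewrite size_map size_iota ltnNge => /negP; case.
  rewrite (leq_trans (size_polyD _ _)) // geq_max size_polyN size_map_poly sizeg.
  by rewrite (leq_trans (size_polyC_leq1 _)) // prime_gt0 // (pcharf_prime pcharF).
exists g`_0; rewrite -coef_map; move/eqP: g0x; rewrite subr_eq0 => /eqP ->.
by rewrite coefC.
Qed.
End Cyclic.
End SimpleExtension.

(** * Minimal polynomials and Artin's fixed field argument *)

Lemma ex_minpoly (K : fieldType) (T : closedFieldType) (f : {rmorphism K -> T})
    (x : T) :
  algebraicOver f x -> exists q, is_minpoly f x q.
Proof.
case=> q0 q0n q0x.
pose P n := `[< exists r : {poly K}, [/\ r != 0, root (map_poly f r) x & size r = n] >].
have exP : exists n, P n by exists (size q0); apply/asboolP; exists q0.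
case: (ex_minnP exP) => n /asboolP[q [qn qx sizeq]] nmin.
have lq0 : (lead_coef q)^-1 != 0 by rewrite invr_eq0 lead_coef_eq0.
have qx' : root (map_poly f ((lead_coef q)^-1 *: q)) x.
  by rewrite map_polyZ rootZ // fmorph_eq0.
exists ((lead_coef q)^-1 *: q); split=> //.
  by rewrite monicE lead_coefZ mulVf // lead_coef_eq0.
apply/(subfx_irreducibleP qx'); first by rewrite scaler_eq0 negb_or lq0.
move=> r rx rn; rewrite size_scale // sizeq; apply: nmin.
by apply/asboolP; exists r.
Qed.

Section Artin.
Variables (K E : fieldType) (T : closedFieldType).
Variables (i : {rmorphism K -> E}) (j : {rmorphism E -> T}) (f : {rmorphism K -> T}).
Hypothesis jiE : forall x, j (i x) = f x.
Variable S : set {rmorphism E -> E}.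
Hypothesis Si : forall h, S h -> forall x, h (i x) = i x.
Hypothesis fixS : forall x, (forall h, S h -> h x = x) -> exists y, x = i y.

Lemma split_of_fixed (q : {poly K}) (x : E) :
  irreducible_poly q -> root (map_poly i q) x ->
  exists2 rs : seq E, uniq rs & map_poly i q %= \prod_(r <- rs) ('X - r%:P).
Proof.
move=> qirr qx.
have [rs [rs_uniq mem_rs]] : exists rs : seq E, uniq rs /\ rs =i root (map_poly i q).
  have [ts tsE] := closed_field_poly_normal (map_poly f q).
  (* [g] inverts [j] on its image and takes the default value 0 elsewhere; the filter on roots of
     [q] discards any spurious value. *)
  pose g y := xget 0 [set z | j z = y].
  exists (undup [seq z <- map g ts | root (map_poly i q) z]).
  split=> [|z]; first exact: undup_uniq.
  rewrite mem_undup mem_filter andb_idr // => qz.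
  have jz : j z \in ts.
    rewrite -root_prod_XsubC -(@rootZ _ _ (lead_coef (map_poly f q))).
      by rewrite -tsE -(eq_map_poly jiE) map_poly_comp /root horner_map (eqP qz) rmorph0.
    by rewrite lead_coef_eq0 map_poly_eq0 irredp_neq0.
  apply/mapP; exists (j z) => //; apply: (fmorph_inj j).
  by have /xgetPex -> : exists z', j z' = j z by exists z.
exists rs => //.
set R := \prod_(r <- rs) _.
(* [h] is injective and maps the finite set of roots into itself, hence permutes it. *)
have RS h : S h -> map_poly h R = R.
  move=> Sh; rewrite /R rmorph_prod.
  under eq_bigr => r _ do rewrite /= map_polyXsubC.
  rewrite -(big_map h xpredT (fun r => 'X - r%:P)); apply: perm_big.
  have h_uniq : uniq (map h rs) by rewrite map_inj_uniq //; exact: fmorph_inj.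
  have sub_rs : {subset map h rs <= rs}.
    move=> _ /mapP[r rrs ->]; move: rrs; rewrite !mem_rs !unfold_in => qr.
    have -> : map_poly i q = map_poly h (map_poly i q).
      by rewrite -map_poly_comp (eq_map_poly (Si Sh)).
    by rewrite /root horner_map (eqP qr) rmorph0.
  have [] := uniq_min_size h_uniq sub_rs; first by rewrite size_map.
  by move=> _ ers; exact: uniq_perm.
have /choice[c cE] : forall k, exists y, R`_k = i y.
  by move=> k; apply: fixS => h Sh; rewrite -coef_map RS.
have RE : R = map_poly i (\poly_(k < size R) c k).
  apply/polyP => k; rewrite coef_map coef_poly; case: ltnP => [_|le]; first exact: cE.
  by rewrite /= rmorph0 nth_default.
(* [q] divides [R] because [R] has coefficients in [K] and vanishes at [x]; [R] divides [q] because
   its roots are distinct roots of [q]. *)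
rewrite /eqp; apply/andP; split.
  rewrite RE dvdp_map; apply: (root_irreducible_dvdp qirr qx).
  by rewrite -RE root_prod_XsubC mem_rs.
apply: uniq_roots_dvdp; last by rewrite uniq_rootsE.
by apply/allP => r; rewrite mem_rs.
Qed.

Lemma galois_of_fixed :
  (forall x : E, algebraicOver f (j x)) -> galois_ext f (range j).
Proof.
have root_E (q : {poly K}) x : root (map_poly f q) (j x) -> root (map_poly i q) x.
  by rewrite -(eq_map_poly jiE) map_poly_comp /root horner_map fmorph_eq0.
move=> alg; split.
- exact: is_subfield_range.
- by move=> _ [x _ <-]; exists (i x).
- move=> _ [x _ <-]; have [q [qm qirr qx]] := ex_minpoly (alg x).
  exists q => //; have [rs rs_uniq qE] := split_of_fixed qirr (root_E q x qx).
  by rewrite -(separable_map i) (eqp_separable qE) separable_prod_XsubC.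
move=> _ [x _ <-]; split=> // q qirr /root_E qx.
have [rs _ qE] := split_of_fixed qirr qx.
exists (map j rs) => [_ /mapP[r _ ->]|]; first by apply/mem_set; exists r.
rewrite -(eq_map_poly jiE) map_poly_comp big_map.
move: qE; rewrite -(eqp_map j) rmorph_prod.
by under eq_bigr => r _ do rewrite /= map_polyXsubC.
Qed.
End Artin.

(** * Restricting automorphisms, and their action on [b] modulo the image of [AS] *)

Lemma Gal_rmorphism (K E : fieldType) (T : closedFieldType)
    (f : {rmorphism K -> T}) (A : set T) (sigma : T -> T) (j : {rmorphism E -> T}) :
  Gal f A sigma -> range j `<=` A ->
  exists s : {rmorphism E -> T}, forall x, s x = sigma (j x).
Proof.
move=> [_ sD sM sK] jA.
have jA' x : j x \in A by apply/mem_set/jA; exists x.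
have [||s sE] := @rmorphism_of E T (sigma \o j); last by exists s.
  move=> x y /=; rewrite -[in RHS](subrK y x) (rmorphD j (x - y)) sD ?addrK //.
split=> [|x y] /=; first by rewrite rmorph1 -(rmorph1 f) sK.
by rewrite rmorphM sM.
Qed.

Lemma eq_rmorphism_gen (F E T : fieldType) (i : {rmorphism F -> E}) (t : E)
    (s1 s2 : {rmorphism E -> T}) :
  (forall x, exists g : {poly F}, x = (map_poly i g).[t]) ->
  (forall x, s1 (i x) = s2 (i x)) -> s1 t = s2 t -> s1 =1 s2.
Proof.
move=> gen si st x; have [g ->] := gen x.
by rewrite -!horner_map st -!map_poly_comp (eq_map_poly si).
Qed.

(** Modulo the image of [AS], each application of [h] multiplies [b] by [n]. After [p] applications,
    [(1 - n) b] is in that image, and a nonzero [1 - n] could be divided out. *)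
Lemma AS_multiplier_eq1 (p : nat) (F : fieldType) (h : {rmorphism F -> F})
    (b c : F) (n : nat) :
  p \in [pchar F] -> iter p h b = b -> (forall y, AS p y <> b) ->
  h b = n%:R * b + AS p c -> n%:R = 1 :> F.
Proof.
move=> pcharF hp nb hb.
have iterE k : exists d, iter k h b = (n ^ k)%:R * b + AS p d.
  elim: k => [|k [d dE]].
    by exists 0; rewrite (AS_nat pcharF 0) addr0 mul1r.
  exists ((n ^ k)%:R * c + h d); rewrite iterS dE rmorphD rmorphM rmorph_nat hb.
  rewrite rmorph_AS (AS_D pcharF) (AS_natM pcharF) expnSr natrM; ring.
have [d] := iterE p; rewrite hp natrX.
have := pFrobenius_aut_nat pcharF n; rewrite pFrobenius_autE => -> bE.
apply/eqP; apply: contraT => n1; pose e : F := 1 - n%:R.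
have e0 : e != 0 by rewrite subr_eq0 eq_sym.
have ep : e ^+ p = e.
  apply/eqP; rewrite -subr_eq0 -/(AS p e) (AS_B pcharF) (AS_nat pcharF 1).
  by rewrite (AS_nat pcharF) subrr.
(* Since [e] is in the prime field, dividing by it commutes with [AS], so [AS p d = e * b] gives
   [AS p (d / e) = b]. *)
case: (nb (d / e)); rewrite /AS exprMn exprVn ep -mulrBl -/(AS p d).
have -> : AS p d = e * b by rewrite /e mulrBl mul1r {1}bE addrC addKr.
by rewrite mulrAC mulfV // mul1r.
Qed.

(** The [n]-th iterate sends [t] to [t + n], and [p] is zero in [E]. *)
Lemma AS_iter_id (p : nat) (F E : fieldType) (i : {rmorphism F -> E}) (t : E)
    (h : {rmorphism E -> E}) (x : E) :
  p \in [pchar E] -> (forall x, exists g : {poly F}, x = (map_poly i g).[t]) ->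
  (forall y, h (i y) = i y) -> h t = t + 1 -> iter p h x = x.
Proof.
move=> pcharE gen hi ht; have [g ->] := gen x.
have iterE n : iter n h (map_poly i g).[t] = (map_poly i g).[t + n%:R].
  elim: n => [|n IHn]; first by rewrite addr0.
  rewrite iterS IHn -horner_map rmorphD ht rmorph_nat -map_poly_comp (eq_map_poly hi).
  by rewrite -addrA nat1r.
by rewrite iterE (pcharf0 pcharE) addr0.
Qed.

(** * The tower [K], [L], [M], where [h] stands for the restriction of sigma to [L] *)

Section Tower.
Variables (p : nat) (K L M : fieldType) (Kbar : closedFieldType).
Variables (f : {rmorphism K -> Kbar}) (i1 : {rmorphism K -> L}).
Variables (j1 : {rmorphism L -> Kbar}) (i2 : {rmorphism L -> M}).
Variables (j2 : {rmorphism M -> Kbar}) (t : M) (b : L).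
Hypotheses (pcharK : p \in [pchar K]) (f_alg : forall x, algebraicOver f x).
Hypotheses (j1E : forall x, j1 (i1 x) = f x) (j2E : forall x, j2 (i2 x) = j1 x).
Hypothesis gen_t : forall x, exists g : {poly L}, x = (map_poly i2 g).[t].
Hypotheses (tb : AS p t = i2 b) (nb : forall y, AS p y <> b).
Variable h : {rmorphism L -> L}.
Hypotheses (h_id : forall x, h (i1 x) = i1 x) (h_iter : iter p h b = b).
Hypothesis h_fixed : forall x, h x = x -> exists y, x = i1 y.

Let pcharL : p \in [pchar L]. Proof. by rewrite (fmorph_pchar i1). Qed.
Let pcharM : p \in [pchar M]. Proof. by rewrite (fmorph_pchar i2). Qed.

Lemma galois_tower (c : L) : h b - b = AS p c -> galois_ext f (range j2).
Proof.
move=> hb.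
have [tau tau_id tau_t] := AS_translation gen_t pcharL tb nb.
have [rho rho_h _] : exists2 rho : {rmorphism M -> M},
    forall x, rho (i2 x) = i2 (h x) & rho t = t + i2 c.
  (* The image [t + i2 c] is admissible because [b + AS p c = h b]. *)
  apply: (extend_AS gen_t pcharL tb nb (s := i2 \o h)).
  by rewrite (AS_D pcharM) tb -rmorph_AS -hb -rmorphD addrC subrK.
apply: (@galois_of_fixed _ _ _ (i2 \o i1) j2 f _ [set tau; rho]) => [x|g|x|] //=.
- by rewrite j2E j1E.
- by move=> [->|->] x /=; [rewrite tau_id | rewrite rho_h h_id].
move=> gx; have tau_x : tau x = x by apply: gx; left.
have [y yE] := AS_fixed gen_t pcharL tb tau_id tau_t tau_x.
have /h_fixed[z zE] : h y = y.
  by apply: (fmorph_inj i2); rewrite -rho_h -yE; apply: gx; right.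
by exists z; rewrite yE zE.
Qed.

Lemma tower_galois (sigma : Kbar -> Kbar) :
  Gal f (Ksep f) sigma -> (forall x, sigma (j1 x) = j1 (h x)) ->
  galois_ext f (range j2) -> exists c, h b - b = AS p c.
Proof.
move=> sG sigma_h [_ _ Msep Mnorm].
(* Separability puts [M] inside [Ksep], where [sigma] is a morphism. *)
have [s sE] := Gal_rmorphism sG Msep.
have [q [_ qirr qt]] := ex_minpoly (f_alg (j2 t)).
have /= si x : s (i2 (i1 x)) = f x by rewrite sE j2E sigma_h h_id j1E.
have ji x : j2 (i2 (i1 x)) = f x by rewrite j2E j1E.
(* [sigma] maps [j2 t] to a root of its minimal polynomial, hence into [M]. *)
have [u su] : exists u, s t = j2 u.
  have [_ /(_ q qirr qt)[rs rsM qE]] := Mnorm (j2 t) (ex_intro2 _ _ t I erefl).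
  have : root (map_poly f q) (s t).
    have -> : map_poly f q = map_poly s (map_poly (i2 \o i1) q).
      by rewrite -map_poly_comp; apply: eq_map_poly => x; rewrite /= si.
    rewrite /root horner_map fmorph_eq0 -(fmorph_eq0 j2) -horner_map -map_poly_comp.
    by rewrite (eq_map_poly ji).
  rewrite (eqp_root qE) root_prod_XsubC => /rsM /set_mem[u _ uE].
  by exists u.
have ub : AS p u = i2 (h b).
  by apply: (fmorph_inj j2); rewrite rmorph_AS -su -rmorph_AS tb sE !j2E sigma_h.
have [tau tau_id tau_t] := AS_translation gen_t pcharL tb nb.
(* [tau] fixes [L], hence [h b]; so [u] and [tau u] have the same image under [AS] and differ by an
   element of the prime field. *)
have tau_ub : AS p (tau u) = i2 (h b) by rewrite -rmorph_AS ub tau_id.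
have [n _ tau_u] := AS_eqP pcharM ub tau_ub.
(* [tau] adds [n] both to [u] and to [n%:R * t], so the difference is fixed and descends to [L]. *)
have /(AS_fixed gen_t pcharL tb tau_id tau_t)[c cE] :
    tau (u - n%:R * t) = u - n%:R * t.
  by rewrite rmorphB rmorphM rmorph_nat tau_t tau_u; ring.
have hb : h b = n%:R * b + AS p c.
  apply: (fmorph_inj i2); rewrite rmorphD rmorphM rmorph_nat -ub -tb rmorph_AS -cE.
  by rewrite (AS_B pcharM) (AS_natM pcharM) addrC subrK.
exists c; have n1 := AS_multiplier_eq1 pcharL h_iter nb hb.
by rewrite hb n1 mul1r addrC addKr.
Qed.
End Tower.

(** * Passage from subsets of [Kbar] to the tower of field types *)

Unset Implicit Arguments.
Set Strict Implicit.

Theorem lemma2p9 (p : nat) (K : fieldType) (Kbar : closedFieldType)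
    (iota : {rmorphism K -> Kbar}) (alpha eta b : Kbar)
    (sigma : Kbar -> Kbar) (L M : set Kbar) :
  p \in [pchar K] ->
  is_algebraic_closure iota ->
  (range iota `\` (AS p @` range iota)) (AS p alpha) ->
  L = adjoin (range iota) alpha ->
  Gal iota (Ksep iota) sigma ->
  sigma alpha = alpha + 1 ->
  b = AS p eta ->
  (L `\` (AS p @` L)) b ->
  M = adjoin L eta ->
  galois_ext iota M <-> (AS p @` L) (sigma b - b).
Proof.
move=> pcharK alg [[a _ a_alpha] na] LE sG s_alpha bE [Lb nb] ME.
have na' y : AS p y <> a.
  move=> ya; apply: na; exists (iota y); first by exists y.
  by rewrite -rmorph_AS ya.
have [L' [i1 [j1 [t1 [j1E j1t j1L gen1]]]]] := adjoin_fieldType (alg alpha).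
have pcharL : p \in [pchar L'] by rewrite (fmorph_pchar i1).
have t1a : AS p t1 = i1 a.
  by apply: (fmorph_inj j1); rewrite rmorph_AS j1t j1E a_alpha.
rewrite -j1L in LE; rewrite {L}LE in Lb nb ME *.
have [h h_id h_t] := AS_translation gen1 pcharK t1a na'.
have h_fixed x : h x = x -> exists y, x = i1 y.
  exact: (AS_fixed gen1 pcharK t1a h_id h_t).
(* The single endomorphism [h] has fixed field [K], so [L] is separable over [K] and [sigma]
   restricts to a morphism on it. *)
have [_ _ Lsep _] : galois_ext iota (range j1).
  apply: (@galois_of_fixed _ _ _ i1 j1 iota j1E [set h]) => [_ ->|x /(_ h erefl)|] //.
  exact: h_fixed.
(* Both sides are morphisms over [K] that send the generator to [alpha + 1]. *)
have sigma_h x : sigma (j1 x) = j1 (h x).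
  have [s sE] := Gal_rmorphism sG Lsep.
  rewrite -sE; apply: (eq_rmorphism_gen (s2 := j1 \o h) gen1) => [y|] /=.
    by rewrite sE h_id j1E; case: sG => _ _ _ ->.
  by rewrite sE j1t s_alpha h_t rmorphD j1t rmorph1.
case: Lb => b0 _ b0E; rewrite -{b}b0E in bE nb *.
have nb0 y : AS p y <> b0.
  move=> yb; apply: nb; exists (j1 y); first by exists y.
  by rewrite -rmorph_AS yb.
have j1_alg : algebraicOver j1 eta.
  exists (AS_poly p b0); first by rewrite monic_neq0 // monic_AS_poly.
  by rewrite map_AS_poly root_AS_poly bE.
have [M' [i2 [j2 [t2 [j2E j2t j2M gen2]]]]] := adjoin_fieldType j1_alg.
have t2b : AS p t2 = i2 b0.
  by apply: (fmorph_inj j2); rewrite rmorph_AS j2t j2E bE.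
have h_iter : iter p h b0 = b0 by exact: AS_iter_id pcharL gen1 h_id h_t.
rewrite ME -j2M sigma_h -rmorphB; split.
  move/(tower_galois pcharK alg j1E j2E gen2 t2b nb0 h_id h_iter sG sigma_h).
  move=> [c cE]; exists (j1 c); first by exists c.
  by rewrite -rmorph_AS cE.
move=> [_ [c _ <-]]; rewrite -rmorph_AS => /fmorph_inj/esym.
exact: (galois_tower pcharK alg j1E j2E gen2 t2b nb0 h_id h_fixed).
Qed.
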